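(* Let $n>1$ be an integer, $\delta'>0$ and $\lambda\in\mathbb{R}$, $\lambda\neq0$. There is no polynomial $P(z)\in\mathbb{R}[z]$ of degree $m\geq 1$ satisfying $$\frac{d}{dz}\left(\left(z^{2}-\delta'^{2}\right)\frac{d\,P^{n}(z)}{dz}\right)=\lambda P(z).$$
   Context: Here $P^n(z)$ denotes the $n$-th power $(P(z))^n$. A non-trivial polynomial solution is understood to have degree $m\geq1$. *)

(* Defs.v *)
From mathcomp Require Import all_boot all_order all_algebra.
From mathcomp Require Import reals.

(* Main.v *)
(* The operator on the left preserves the degree of a nonconstant polynomial, so
   it sends P ^+ n to a polynomial of degree m * n > m: compare the coefficients
   of degree m * n. *)
Require Import Defs.
From mathcomp Require Import all_boot all_order all_algebra.
From mathcomp Require Import reals.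

Set Implicit Arguments.
Unset Strict Implicit.
Unset Printing Implicit Defensive.

Import Order.TTheory GRing.Theory Num.Theory.
Local Open Scope ring_scope.

(** If [P] has leading coefficient a and d = mn, the left side has coefficient d(d+1)a^n in degree
    d, nonzero in characteristic 0; the right side has degree at most m < d. *)

Lemma coef_deriv_quadratic_mul_deriv (R : nzRingType) (c : R) (Q : {poly R})
    (N : nat) (sQ : size Q = N.+2) :
  ((('X^2 - c%:P) * Q^`())^`())`_N.+1 = lead_coef Q *+ N.+1 *+ N.+2.
Proof.
rewrite coef_deriv mulrBl coefB coefXnM coefCM !coef_deriv subn2 /=.
(* The [c] term only involves a coefficient of [Q] above its degree [N.+1]. *)
rewrite [Q`_N.+3]nth_default ?sQ // mul0rn mulr0 subr0.
by rewrite lead_coefE sQ.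
Qed.

(* MathComp; a polynomial of degree m has size m.+1. *)
Theorem mainTheorem2 (R : realType) (n : nat) (delta' lambda : R)
    (n_gt1 : (1 < n)%N) (delta'_gt0 : 0 < delta') (lambda_neq0 : lambda <> 0) :
  ~ exists (m : nat) (P : {poly R}),
      [/\ (1 <= m)%N,
          size P = m.+1
        & (('X^2 - (delta' ^+ 2)%:P) * (P ^+ n)^`())^`() = lambda *: P].
Proof.
case=> m [P [m_gt0 sP odeP]].
have P_neq0 : P != 0 by rewrite -size_poly_eq0 sP.
have sQ : size (P ^+ n) = (m * n).+1.
  by rewrite -[LHS]prednK ?size_exp ?sP // size_poly_gt0 expf_neq0.
have N_gt0 : (0 < m * n)%N by rewrite muln_gt0 m_gt0 ltnW.
have := congr1 (fun q : {poly R} => q`_(m * n)) odeP.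
rewrite -(prednK N_gt0) coef_deriv_quadratic_mul_deriv; last by rewrite sQ prednK.
(* Here [1 < n] enters: m < mn, so the right side vanishes in this degree. *)
rewrite prednK // coefZ [P`_(m * n)]nth_default ?sP ?ltn_Pmulr // mulr0 => /eqP.
by rewrite !mulrn_eq0 /= lead_coef_eq0 expf_eq0 (negPf P_neq0) andbF orbF eqn0Ngt N_gt0.
Qed.
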